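(* Let $\kappa,\sigma_1,\sigma_2>0$ satisfy the scaling relation $\sigma_1=\kappa^2\sigma_2$, let $\Delta t>0$, and consider a periodic mesh with Fourier spectral spatial operators. Let $(\phi^n,\psi^n,\boldsymbol A^n,\boldsymbol U^n,\rho^n)_{n\ge 0}$ be mesh fields and $(\boldsymbol J^{n+1/2})_{n\ge0}$ mesh currents such that for every $n\ge 0$ the Crank--Nicolson update $$\frac{\phi^{n+1}-\phi^n}{\Delta t}=\psi^{n+1/2},\qquad \frac{\psi^{n+1}-\psi^n}{\Delta t}=\kappa^2\Delta_h\phi^{n+1/2}+\kappa^2\sigma_1\rho^{n+1/2},$$ $$\frac{\boldsymbol A^{n+1}-\boldsymbol A^n}{\Delta t}=\boldsymbol U^{n+1/2},\qquad \frac{\boldsymbol U^{n+1}-\boldsymbol U^n}{\Delta t}=\kappa^2\Delta_h\boldsymbol A^{n+1/2}+\kappa^2\sigma_2\boldsymbol J^{n+1/2}$$ and the discrete continuity equation $$\frac{\rho^{n+1}-\rho^n}{\Delta t}+\nabla_h\cdot\boldsymbol J^{n+1/2}=0$$ hold. For each resolved Fourier mode $\boldsymbol k$ define the Lorenz and Gauss residuals $$g^n_{\boldsymbol k}=\frac1{\kappa^2}\hat\psi^n_{\boldsymbol k}+\mathrm i\boldsymbol k\cdot\hat{\boldsymbol A}^n_{\boldsymbol k},\qquad r^n_{\boldsymbol k}=\mathrm i\boldsymbol k\cdot\hat{\boldsymbol E}^n_{\boldsymbol k}-\sigma_1\hat\rho^n_{\boldsymbol k},\qquad \hat{\boldsymbol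 E}^n_{\boldsymbol k}=-\mathrm i\boldsymbol k\,\hat\phi^n_{\boldsymbol k}-\hat{\boldsymbol U}^n_{\boldsymbol k}.$$ If the initial data satisfy the Lorenz and Gauss constraints mode by mode, i.e. $g^0_{\boldsymbol k}=0$ and $r^0_{\boldsymbol k}=0$ for every resolved mode $\boldsymbol k$, then $g^n_{\boldsymbol k}=0$ and $r^n_{\boldsymbol k}=0$ for every resolved mode $\boldsymbol k$ and every $n\ge0$; that is, the Lorenz gauge and Gauss's law are preserved.
   Context: For quantities $f$ stored at integer time levels, $f^{n+1/2}:=\tfrac12(f^{n+1}+f^n)$ (this applies to $\phi,\psi,\boldsymbol A,\boldsymbol U,\rho$). The current $\boldsymbol J^{n+1/2}$ is a given mesh vector field attached to the half step. All fields are periodic mesh functions on a uniform mesh (scalar: $\phi,\psi,\rho$; three-component vector: $\boldsymbol A,\boldsymbol U,\boldsymbol J,\boldsymbol E$), all stored at the same mesh points (unstaggered). $\hat f_{\boldsymbol k}$ denotes the discrete Fourier coefficient of $f$ for the mode with real wave vector $\boldsymbol k$, with $\boldsymbol k$ ranging over the finite set of resolved modes (the zero mode included). Fourier spectral operators act mode by mode: $\nabla_h\mapsto \mathrm i\boldsymbol k$, $\nabla_h\cdot\mapsto\mathrm i\boldsymbol k\cdot$, $\Delta_h\mapsto-|\boldsymbol k|^2$, where the same $\boldsymbol k$ is used in all operators. Here $\phi$ is the scalar potential, $\boldsymbol A$ the vector potential, $\psi$ and $\boldsymbol U$ their discrete time derivatives, $\rho$ the charge density, $\boldsymbol E=-\nabla_h\phi-\boldsymbol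 U$ the electric field, $\kappa$ the nondimensional speed of light, and $\sigma_1,\sigma_2$ the source coefficients. *)

(* Defs.v *)
From HB Require Import structures.
From mathcomp Require Import all_boot all_order all_algebra.
From mathcomp Require Import finmap.
From mathcomp Require Import complex.
From mathcomp Require Import reals trigo.
From mathcomp Require Import ring lra.

Set Implicit Arguments.
Unset Strict Implicit.
Unset Printing Implicit Defensive.

Import Order.TTheory GRing.Theory Num.Theory.
Local Open Scope ring_scope.

(* A uniform periodic mesh in the box prod_j [0, period j), with npts j points
   in direction j (npts j = 1 for a direction in which nothing varies, so one-
   and two-dimensional meshes are included), together with its resolved modes.
   A mode is given by its integer wave numbers.  On the mesh, wave numbers that
   agree modulo npts define the same plane wave, so distinct resolved modes
   have to be distinct modulo npts; which representative is resolved (e.g. the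
   sign of the Nyquist wave number) is left free, as is whether all the classes
   are resolved (e.g. the Nyquist modes may be left out). *)
Record spectral_mesh (R : realType) := SpectralMesh {
  npts : 'I_3 -> nat;
  npts_gt0 : forall j, (0 < npts j)%N;
  period : 'I_3 -> R;
  period_gt0 : forall j, 0 < period j;
  modes : {fset 'rV[int]_3};
  modes0 : 0 \in modes;
  modes_unaliased : {in modes &, forall m m' : 'rV[int]_3,
    (forall j, (m 0%R j = m' 0%R j %[mod (npts j)%:Z])%Z) -> m = m'}
}.

Section Fourier.
Variables (R : realType) (M : spectral_mesh R).
Local Notation C := R[i].

Definition mesh_point : Type := {dffun forall j : 'I_3, 'I_(npts M j)}.
HB.instance Definition _ := Finite.on mesh_point.

Definition mesh_coord (x : mesh_point) : 'rV[R]_3 :=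
  \row_j (period M j * (x j : nat)%:R / (npts M j)%:R).

Definition wavevec (m : 'rV[int]_3) : 'rV[R]_3 :=
  \row_j (2 * pi * (m 0 j)%:~R / period M j).

(* Bilinear: no complex conjugation. *)
Definition kdot (k : 'rV[R]_3) (a : 'rV[C]_3) : C :=
  \sum_j (k 0 j)%:C%C * a 0 j.

Definition normk2 (k : 'rV[R]_3) : R := \sum_j k 0 j ^+ 2.

Definition cis (t : R) : C := (cos t +i* sin t)%C.

Definition phase (m : 'rV[int]_3) (x : mesh_point) : R :=
  \sum_j wavevec m 0 j * mesh_coord x 0 j.

Definition fcoef (V : lmodType C) (f : mesh_point -> V) (m : 'rV[int]_3) : V :=
  (#|{: mesh_point}|%:R)^-1 *: \sum_(x : mesh_point) cis (- phase m x) *: f x.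

Definition synth (V : lmodType C) (F : 'rV[int]_3 -> V) (x : mesh_point) : V :=
  \sum_(m <- modes M) cis (phase m x) *: F m.

Definition igradk (k : 'rV[R]_3) (c : C) : 'rV[C]_3 :=
  \row_j ('i%C * (k 0 j)%:C%C * c).

Definition grad_h (f : mesh_point -> C) : mesh_point -> 'rV[C]_3 :=
  synth (fun m => igradk (wavevec m) (fcoef f m)).

Definition div_h (u : mesh_point -> 'rV[C]_3) : mesh_point -> C :=
  synth (fun m => 'i%C * kdot (wavevec m) (fcoef u m)).

(* Used for scalar fields (V = C) and, componentwise, for vector fields. *)
Definition lap_h (V : lmodType C) (f : mesh_point -> V) : mesh_point -> V :=
  synth (fun m => (- normk2 (wavevec m))%:C%C *: fcoef f m).

Definition efield (phi : mesh_point -> C) (U : mesh_point -> 'rV[C]_3) :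
    mesh_point -> 'rV[C]_3 :=
  fun x => - grad_h phi x - U x.

Definition half_step (V : lmodType C) (f : nat -> mesh_point -> V) (n : nat) :
    mesh_point -> V :=
  fun x => 2^-1 *: (f n.+1 x + f n x).

Definition diff_quot (dt : R) (V : lmodType C) (f : nat -> mesh_point -> V) (n : nat) :
    mesh_point -> V :=
  fun x => (dt^-1)%:C%C *: (f n.+1 x - f n x).

Definition lorenz_residual (kappa : R) (psi : mesh_point -> C)
    (A : mesh_point -> 'rV[C]_3) (m : 'rV[int]_3) : C :=
  (kappa ^- 2)%:C%C * fcoef psi m + 'i%C * kdot (wavevec m) (fcoef A m).

Definition gauss_residual (sigma1 : R) (phi : mesh_point -> C)
    (U : mesh_point -> 'rV[C]_3) (rho : mesh_point -> C) (m : 'rV[int]_3) : C :=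
  'i%C * kdot (wavevec m) (fcoef (efield phi U) m)
  - sigma1%:C%C * fcoef rho m.

Lemma cisD a b : cis (a + b) = cis a * cis b.
Proof.
by rewrite /cis; simpc; rewrite cosD sinD [sin a * cos b + _]addrC.
Qed.

Lemma cis0 : cis 0 = 1.
Proof. by rewrite /cis cos0 sin0. Qed.

Lemma cis_eq1 t : cis t = 1 -> cos t = 1.
Proof. by case. Qed.

Lemma cis_periodic t (z : int) : cis (t + 2 * pi * z%:~R) = cis t.
Proof.
have P u : cis (u + 2 * pi) = cis u.
  by rewrite /cis mulr_natl cosD2pi sinD2pi.
have Pn n u : cis (u + 2 * pi * n%:R) = cis u.
  elim: n => [|n IH]; first by rewrite mulr0 addr0.
  by rewrite -[n.+1%:R]natr1 mulrDr mulr1 addrA P.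
case: z => n; first by rewrite -pmulrn Pn.
by rewrite NegzE mulrNz -pmulrn mulrN -[LHS](Pn n.+1) subrK.
Qed.

Lemma cis_root_neq1 (N : nat) (d : int) : (0 < N)%N ->
  (d %% N%:Z)%Z != 0 -> cis (2 * pi * d%:~R / N%:R) != 1.
Proof.
move=> N0; set r := (d %% N%:Z)%Z => rn0.
have NR : 0 < N%:R :> R by rewrite ltr0n.
have r0 : 0 < r by rewrite lt0r rn0 modz_ge0// eqz_nat -lt0n.
have rN : r < N%:Z by rewrite ltz_pmod.
have -> : 2 * pi * d%:~R / N%:R
    = 2 * pi * r%:~R / N%:R + 2 * pi * ((d %/ N%:Z)%Z)%:~R :> R.
  rewrite {1}(divz_eq d N%:Z) -/r rmorphD rmorphM /= -pmulrn.
  by field; rewrite gt_eqF.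
rewrite cis_periodic; apply/eqP => /cis_eq1.
have -> : 2 * pi * r%:~R / N%:R = (pi * r%:~R / N%:R) *+ 2 :> R by ring.
rewrite cos_mulr2n cos2sin2.
set s := sin _.
have : 0 < s.
  apply: sin_gt0_pi.
  rewrite divr_gt0 ?mulr_gt0 ?pi_gt0 ?ltr0z//=.
  by rewrite ltr_pdivrMr// ltr_pM2l ?pi_gt0// pmulrn ltr_int.
move=> s0 h; have := exprn_gt0 2 s0; lra.
Qed.

Lemma phaseE m x :
  phase m x = \sum_j 2 * pi * (m 0 j)%:~R * (x j : nat)%:R / (npts M j)%:R.
Proof.
apply: eq_bigr => j _; rewrite !mxE.
by field; rewrite gt_eqF ?ltr0n ?npts_gt0// gt_eqF ?period_gt0.
Qed.

Lemma phaseB m m' x : phase (m - m') x = phase m x - phase m' x.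
Proof.
rewrite !phaseE -sumrB; apply: eq_bigr => j _.
by rewrite !mxE rmorphB /=; ring.
Qed.

Definition mesh_shift (j0 : 'I_3) (x : mesh_point) : mesh_point :=
  [ffun j => if j == j0 then ordS (x j) else x j].

Lemma shift_inj j0 : injective (mesh_shift j0).
Proof.
move=> x y /ffunP h; apply/ffunP => j; have := h j; rewrite !ffunE.
by case: ifP => // _; apply: ordS_inj.
Qed.

Lemma cis_phase_shift j0 (m : 'rV[int]_3) x :
  cis (phase m (mesh_shift j0 x))
  = cis (2 * pi * (m 0 j0)%:~R / (npts M j0)%:R) * cis (phase m x).
Proof.
have N0 : (npts M j0)%:R != 0 :> R by rewrite pnatr_eq0 -lt0n npts_gt0.
rewrite -cisD !phaseE (bigD1 j0)//= [in RHS](bigD1 j0)//=.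
rewrite !ffunE eqxx /=.
under eq_bigr => j jj0 do rewrite ffunE (negbTE jj0).
rewrite addrA !cisD; congr (_ * _); rewrite -!cisD.
have /(congr1 (fun n : nat => n%:R : R)) := divn_eq (x j0).+1 (npts M j0).
rewrite natrD natrM -natr1 => e.
have -> : ((x j0).+1 %% npts M j0)%:R
  = (x j0)%:R + 1 - ((x j0).+1 %/ npts M j0)%:R * (npts M j0)%:R :> R.
  by rewrite e; ring.
rewrite -[RHS](cis_periodic _ (m 0 j0 * - ((x j0).+1 %/ npts M j0)%:Z)).
congr cis; rewrite rmorphM rmorphN /= -pmulrn.
by field.
Qed.

Lemma sum_cis_phase (m : 'rV[int]_3) :
  (exists j, (m 0%R j %% (npts M j)%:Z)%Z != 0) ->
  \sum_(x : mesh_point) cis (phase m x) = 0.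
Proof.
move=> [j0 mj0]; set S := \sum_x _.
have : S = cis (2 * pi * (m 0 j0)%:~R / (npts M j0)%:R) * S.
  rewrite {1}/S (reindex_inj (@shift_inj j0)) /= mulr_sumr.
  by apply: eq_bigr => x _; rewrite cis_phase_shift.
move/eqP; rewrite -subr_eq0 -{1}[S]mul1r -mulrBl mulf_eq0 subr_eq0.
by rewrite eq_sym (negbTE (cis_root_neq1 (npts_gt0 M j0) mj0)) => /eqP.
Qed.

Lemma card_point_gt0 : (0 < #|{: mesh_point}|)%N.
Proof.
by apply/card_gt0P; exists [ffun j => Ordinal (npts_gt0 M j)].
Qed.

Lemma cis_orthogonal m m' : m \in modes M -> m' \in modes M ->
  \sum_(x : mesh_point) cis (- phase m x) * cis (phase m' x)
  = if m' == m then #|{: mesh_point}|%:R else 0.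
Proof.
move=> mM m'M; case: eqVneq => [->|mm'].
  under eq_bigr => x _ do rewrite -cisD addNr cis0.
  by rewrite sumr_const.
under eq_bigr => x _ do rewrite -cisD addrC -phaseB.
apply: sum_cis_phase; apply/existsP; apply: contraNT mm'.
rewrite negb_exists => /forallP h; apply/eqP.
apply: (modes_unaliased (s := M)) => // j; apply/eqP.
by rewrite eqz_mod_dvd; apply/dvdz_mod0P; have := h j; rewrite !mxE negbK => /eqP.
Qed.

(* Hence grad_h, div_h and lap_h act mode by mode. *)
Lemma fcoef_synth (V : lmodType C) (F : 'rV[int]_3 -> V) m :
  m \in modes M -> fcoef (synth F) m = F m.
Proof.
move=> mM; rewrite /fcoef /synth.
under eq_bigr => x _ do rewrite scaler_sumr.
rewrite exchange_big /= (big_fsetD1 m)//= big1_fset ?addr0 => [|m'].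
  under eq_bigr => x _ do rewrite scalerA.
  rewrite -scaler_suml cis_orthogonal// eqxx scalerA mulVf ?scale1r//.
  by rewrite pnatr_eq0 -lt0n card_point_gt0.
rewrite !inE => /andP[m'm m'M] _.
under eq_bigr => x _ do rewrite scalerA.
by rewrite -scaler_suml cis_orthogonal// (negbTE m'm) scale0r.
Qed.

Lemma fcoef_efield phi U m : m \in modes M ->
  fcoef (efield phi U) m = - igradk (wavevec m) (fcoef phi m) - fcoef U m.
Proof.
move=> mM; rewrite -[igradk _ _](fcoef_synth
  (fun m => igradk (wavevec m) (fcoef phi m)) mM).
rewrite /fcoef -scalerN -scalerBr; congr (_ *: _).
rewrite -sumrN -sumrB; apply: eq_bigr => x _.
by rewrite scalerBr scalerN.
Qed.

End Fourier.

(* Main.v *)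
Require Import Defs.
From mathcomp Require Import all_boot all_order all_algebra.
From mathcomp Require Import finmap.
From mathcomp Require Import complex.
From mathcomp Require Import reals.
From mathcomp Require Import ring.

(** For a resolved mode [k], the Fourier coefficients of the update and of the
    continuity equation combine into a closed linear recursion for the two
    residuals: writing [f^{n+1/2}] for the mean of [f^n] and [f^{n+1}],
<<
      (g^{n+1} - g^n) / dt = - r^{n+1/2}                      (lorenz_step)
      (r^{n+1} - r^n) / dt = kappa^2 |k|^2 g^{n+1/2}          (gauss_step)
>>
    The sources drop out: [rho] because it enters the [psi] equation exactly as
    it enters [r], and [J] because [sigma1 = kappa^2 sigma2] balances its
    contribution to the [U] equation against the continuity equation.  This is
    the Crank-Nicolson scheme of a harmonic oscillator; starting from
    [(g, r) = (0, 0)], eliminating [r^{n+1}] gives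
    [(1 + dt^2 kappa^2 |k|^2 / 4) g^{n+1} = 0], whose factor is positive since
    [k] is real (crank_nicolson_oscillator_eq0).  Induction on [n] concludes. *)

Set Implicit Arguments.
Unset Strict Implicit.
Unset Printing Implicit Defensive.

Import Order.TTheory GRing.Theory Num.Theory.
Local Open Scope ring_scope.

Section FourierCoefficients.
Variables (R : realType) (M : spectral_mesh R) (V : lmodType R[i]).
Implicit Types (f g : mesh_point M -> V) (m : 'rV[int]_3).

Lemma eq_fcoef f g m : (forall x, f x = g x) -> fcoef f m = fcoef g m.
Proof.
by move=> fg; rewrite /fcoef; congr (_ *: _); apply: eq_bigr => x _; rewrite fg.
Qed.

Lemma fcoefD f g m : fcoef (fun x => f x + g x) m = fcoef f m + fcoef g m.
Proof.
rewrite /fcoef -scalerDr -big_split /=; congr (_ *: _).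
by apply: eq_bigr => x _; rewrite scalerDr.
Qed.

Lemma fcoefZ (a : R[i]) f m : fcoef (fun x => a *: f x) m = a *: fcoef f m.
Proof.
rewrite /fcoef scalerA mulrC -scalerA; congr (_ *: _); rewrite scaler_sumr.
by apply: eq_bigr => x _; rewrite !scalerA mulrC.
Qed.

Lemma fcoefB f g m : fcoef (fun x => f x - g x) m = fcoef f m - fcoef g m.
Proof.
rewrite fcoefD -[- fcoef g m]scaleN1r -fcoefZ; congr (_ + _).
by apply: eq_fcoef => x; rewrite scaleN1r.
Qed.

Lemma fcoef_diff_quot dt (f : nat -> mesh_point M -> V) n m :
  fcoef (diff_quot dt f n) m
  = (dt^-1)%:C%C *: (fcoef (f n.+1) m - fcoef (f n) m).
Proof. by rewrite /diff_quot fcoefZ fcoefB. Qed.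

Lemma fcoef_half_step (f : nat -> mesh_point M -> V) n m :
  fcoef (half_step f n) m = 2^-1 *: (fcoef (f n.+1) m + fcoef (f n) m).
Proof. by rewrite /half_step fcoefZ fcoefD. Qed.

End FourierCoefficients.

Section WaveVectorProduct.
Variable R : realType.
Implicit Types (k : 'rV[R]_3) (a b : 'rV[R[i]]_3) (c : R[i]).

Lemma kdotD k a b : kdot k (a + b) = kdot k a + kdot k b.
Proof. by rewrite -big_split; apply: eq_bigr => j _; rewrite mxE mulrDr. Qed.

Lemma kdotZ k c a : kdot k (c *: a) = c * kdot k a.
Proof. by rewrite mulr_sumr; apply: eq_bigr => j _; rewrite mxE mulrCA. Qed.

Lemma kdotB k a b : kdot k (a - b) = kdot k a - kdot k b.
Proof. by rewrite -scaleN1r kdotD kdotZ mulN1r. Qed.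

Lemma kdot_igradk k c : kdot k (igradk k c) = 'i%C * (normk2 k)%:C%C * c.
Proof.
rewrite /kdot /normk2 rmorph_sum /= mulr_sumr mulr_suml.
by apply: eq_bigr => j _; rewrite mxE rmorphXn /=; ring.
Qed.

Lemma normk2_ge0 k : 0 <= normk2 k.
Proof. by apply: sumr_ge0 => j _; rewrite sqr_ge0. Qed.

End WaveVectorProduct.

(** The term [|k|^2 phi] arises as [i k . (- i k phi)]. *)
Lemma gauss_residualE (R : realType) (M : spectral_mesh R) sigma1
    (phi rho : mesh_point M -> R[i]) (U : mesh_point M -> 'rV[R[i]]_3) m :
  m \in modes M ->
  gauss_residual sigma1 phi U rho m
  = (normk2 (wavevec M m))%:C%C * fcoef phi m
    - 'i%C * kdot (wavevec M m) (fcoef U m) - sigma1%:C%C * fcoef rho m.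
Proof.
move=> mM; rewrite /gauss_residual fcoef_efield// -opprD -scaleN1r kdotZ kdotD.
rewrite kdot_igradk; congr (_ - _).
have i2 : 'i%C * 'i%C = -1 :> R[i] by rewrite -expr2 sqr_i.
rewrite mulN1r mulrN mulrDr opprD !mulrA i2; ring.
Qed.

(** The scalar identities behind the two residual recursions.  They are stated
    over an abstract field: [c], [d], [h], [i], [k2] stand for [kappa], [1 / dt],
    [1 / 2], the imaginary unit and [|k|^2]; [a], [u], [j] for [k . A], [k . U],
    [k . J]; [s] for [sigma1] in the first and [sigma2] in the second; primes
    mark the new time level. *)
Section ScalarIdentities.
Variable F : fieldType.

Lemma lorenz_recursion (c d h i k2 s ps ps' a a' ph ph' u u' rh rh' : F) :
  c != 0 ->
  d * (ps' - ps)
  = c ^+ 2 * (- k2 * (h * (ph' + ph))) + c ^+ 2 * s * (h * (rh' + rh)) ->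
  d * (a' - a) = h * (u' + u) ->
  d * (c ^- 2 * ps' + i * a' - (c ^- 2 * ps + i * a))
  = - (h * (k2 * ph' - i * u' - s * rh' + (k2 * ph - i * u - s * rh))).
Proof.
move=> c0 Hpsi HA.
transitivity (c ^- 2 * (d * (ps' - ps)) + i * (d * (a' - a))); first by ring.
by rewrite Hpsi HA; field.
Qed.

Lemma gauss_recursion (c d h i k2 s j ps ps' a a' ph ph' u u' rh rh' : F) :
  c != 0 ->
  d * (ph' - ph) = h * (ps' + ps) ->
  d * (u' - u) = c ^+ 2 * (- k2 * (h * (a' + a))) + c ^+ 2 * s * j ->
  d * (rh' - rh) = - (i * j) ->
  d * (k2 * ph' - i * u' - c ^+ 2 * s * rh'
       - (k2 * ph - i * u - c ^+ 2 * s * rh))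
  = c ^+ 2 * k2
    * (h * (c ^- 2 * ps' + i * a' + (c ^- 2 * ps + i * a))).
Proof.
move=> c0 Hphi HU Hrho.
transitivity (k2 * (d * (ph' - ph)) - i * (d * (u' - u))
              - c ^+ 2 * s * (d * (rh' - rh))); first by ring.
by rewrite Hphi HU Hrho; field.
Qed.

End ScalarIdentities.

Section ResidualEvolution.
Variables (R : realType) (M : spectral_mesh R) (kappa sigma1 sigma2 dt : R).
Variables (phi psi rho : nat -> mesh_point M -> R[i]).
Variables (A U J : nat -> mesh_point M -> 'rV[R[i]]_3).
Variables (n : nat) (m : 'rV[int]_3).
Hypothesis mM : m \in modes M.

Let k2 : R := normk2 (wavevec M m).
Let g l := lorenz_residual kappa (psi l) (A l) m.
Let r l := gauss_residual sigma1 (phi l) (U l) (rho l) m.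

(** Discrete form of [g' = - r]: the Laplacian of [phi] and the charge density
    in the [psi] equation, and [i k . U] from the [A] equation, are exactly the
    three terms of the Gauss residual. *)
Lemma lorenz_step :
  kappa != 0 ->
  (forall x, diff_quot dt psi n x =
     (kappa ^+ 2)%:C%C *: lap_h (half_step phi n) x
     + (kappa ^+ 2 * sigma1)%:C%C *: half_step rho n x) ->
  (forall x, diff_quot dt A n x = half_step U n x) ->
  (dt^-1)%:C%C * (g n.+1 - g n) = - (2^-1 * (r n.+1 + r n)).
Proof.
move=> kappa0 /(@eq_fcoef _ _ _ _ _ m) Hpsi /(@eq_fcoef _ _ _ _ _ m) HA.
move: Hpsi HA; rewrite !fcoef_diff_quot fcoef_half_step fcoefD 2!fcoefZ.
rewrite fcoef_synth// !fcoef_half_step => Hpsi /(congr1 (kdot (wavevec M m))).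
rewrite !kdotZ kdotB kdotD => HA.
rewrite /r !gauss_residualE// /g /lorenz_residual -/k2.
move: (dt^-1)%:C%C Hpsi HA => d Hpsi HA; rewrite fmorphV rmorphXn /=.
apply: lorenz_recursion; first by rewrite fmorph_eq0.
  by move: Hpsi; rewrite /GRing.scale /= -/k2 rmorphN !(rmorphXn, rmorphM).
exact: HA.
Qed.

(** Discrete form of [r' = kappa^2 |k|^2 g]: the scaling relation and the
    continuity equation make the two current terms cancel. *)
Lemma gauss_step :
  kappa != 0 ->
  sigma1 = kappa ^+ 2 * sigma2 ->
  (forall x, diff_quot dt phi n x = half_step psi n x) ->
  (forall x, diff_quot dt U n x =
     (kappa ^+ 2)%:C%C *: lap_h (half_step A n) x
     + (kappa ^+ 2 * sigma2)%:C%C *: J n x) ->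
  (forall x, diff_quot dt rho n x + div_h (J n) x = 0) ->
  (dt^-1)%:C%C * (r n.+1 - r n)
  = (kappa ^+ 2 * k2)%:C%C * (2^-1 * (g n.+1 + g n)).
Proof.
move=> kappa0 scaling /(@eq_fcoef _ _ _ _ _ m) Hphi.
move=> /(@eq_fcoef _ _ _ _ _ m) HU Hc.
have Hrho : fcoef (diff_quot dt rho n) m = - fcoef (div_h (J n)) m.
  rewrite -scaleN1r -fcoefZ; apply: eq_fcoef => x.
  by rewrite scaleN1r; apply/eqP; rewrite -addr_eq0 Hc.
move: Hphi HU Hrho; rewrite !fcoef_diff_quot fcoef_half_step fcoefD 2!fcoefZ.
rewrite !fcoef_synth// !fcoef_half_step => Hphi HU Hrho.
(* Only the Fourier coefficient of the current matters: it cancels below. *)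
move: (fcoef (J n) m) HU Hrho => j /(congr1 (kdot (wavevec M m))) HU Hrho.
move: HU; rewrite kdotD !kdotZ kdotB kdotD => HU.
rewrite /r !gauss_residualE// /g /lorenz_residual -/k2.
move: (dt^-1)%:C%C Hphi HU Hrho => d Hphi HU Hrho.
rewrite scaling fmorphV !(rmorphXn, rmorphM) /=.
apply: (gauss_recursion (j := kdot (wavevec M m) j)).
- by rewrite fmorph_eq0.
- exact: Hphi.
- by move: HU; rewrite -/k2 rmorphN !(rmorphXn, rmorphM).
- exact: Hrho.
Qed.

End ResidualEvolution.

(** One Crank-Nicolson step of the oscillator [g' = - r], [r' = w g] out of the
    origin stays there: for [0 <= w] the implicit step is uniquely solvable. *)
Lemma crank_nicolson_oscillator_eq0 (R : realType) (dt w : R) (g r : R[i]) :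
  dt != 0 -> 0 <= w ->
  (dt^-1)%:C%C * g = - (2^-1 * r) -> (dt^-1)%:C%C * r = w%:C%C * (2^-1 * g) ->
  g = 0 /\ r = 0.
Proof.
move=> dt0 w0; have dtC0 : dt%:C%C != 0 :> R[i] by rewrite fmorph_eq0.
rewrite fmorphV /= => Hg Hr.
have Eg : g = - (dt%:C%C * 2^-1 * r).
  by rewrite -[LHS](mulVKf dtC0) Hg; ring.
have Er : r = dt%:C%C * w%:C%C * 2^-1 * g.
  by rewrite -[LHS](mulVKf dtC0) Hr; ring.
have : (1 + dt ^+ 2 * w / 4)%:C%C * g = 0.
  rewrite rmorphD !rmorphM rmorph1 fmorphV rmorph_nat /=.
  (* Only the first summand g is expanded: the two equations compose to
     g = - (dt ^+ 2 * w / 4) * g. *)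
  by rewrite mulrDl mul1r {1}Eg Er; field.
move/eqP; rewrite mulf_eq0 fmorph_eq0 gt_eqF /=; last first.
  apply: ltr_wpDr; last by rewrite ltr01.
  by apply: divr_ge0; [apply: mulr_ge0; [apply: sqr_ge0 |] | apply: ler0n].
by move/eqP => g0; rewrite Er g0 mulr0.
Qed.

Theorem theorem3p1 (R : realType) (M : spectral_mesh R)
  (kappa sigma1 sigma2 dt : R)
  (kappa_gt0 : 0 < kappa) (sigma1_gt0 : 0 < sigma1) (sigma2_gt0 : 0 < sigma2)
  (scaling : sigma1 = kappa ^+ 2 * sigma2)
  (dt_gt0 : 0 < dt)
  (phi psi rho : nat -> mesh_point M -> R[i])
  (A U J : nat -> mesh_point M -> 'rV[R[i]]_3)
  (* J n stands for the current J^{n+1/2} *)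
  (phi_update : forall n x, diff_quot dt phi n x = half_step psi n x)
  (psi_update : forall n x, diff_quot dt psi n x =
     (kappa ^+ 2)%:C%C *: lap_h (half_step phi n) x
     + (kappa ^+ 2 * sigma1)%:C%C *: half_step rho n x)
  (A_update : forall n x, diff_quot dt A n x = half_step U n x)
  (U_update : forall n x, diff_quot dt U n x =
     (kappa ^+ 2)%:C%C *: lap_h (half_step A n) x
     + (kappa ^+ 2 * sigma2)%:C%C *: J n x)
  (continuity : forall n x, diff_quot dt rho n x + div_h (J n) x = 0)
  (lorenz0 : forall k, k \in modes M ->
     lorenz_residual kappa (psi 0%N) (A 0%N) k = 0)
  (gauss0 : forall k, k \in modes M ->
     gauss_residual sigma1 (phi 0%N) (U 0%N) (rho 0%N) k = 0) :
  forall n k, k \in modes M ->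
    lorenz_residual kappa (psi n) (A n) k = 0 /\
    gauss_residual sigma1 (phi n) (U n) (rho n) k = 0.
Proof.
have kappa0 : kappa != 0 by rewrite gt_eqF.
elim=> [|n IHn] k kM; first by split; [apply: lorenz0 | apply: gauss0].
have [gn0 rn0] := IHn k kM.
apply: (@crank_nicolson_oscillator_eq0 _ dt
          (kappa ^+ 2 * normk2 (wavevec M k))).
- by rewrite gt_eqF.
- by rewrite mulr_ge0 ?sqr_ge0 ?normk2_ge0.
- have := lorenz_step kM kappa0 (psi_update n) (A_update n).
  by rewrite gn0 rn0 subr0 addr0.
- have := gauss_step kM kappa0 scaling (phi_update n) (U_update n)
    (continuity n).
  by rewrite gn0 rn0 subr0 addr0.
Qed.
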